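(* Let $\mathbf{M}=(c_{i,j})_{i,j=0}^{\infty}$ be an infinite HPD (Hermitian positive definite) matrix and let $z_0\in\mathbb{C}$. Then the following statements are equivalent: (1) $z_0$ is a bounded point evaluation for $P^{2}(\mathbf{M})$. (2) $\gamma_{z_0}(\mathbf{M})>0$.
   Context: An infinite matrix $\mathbf{M}=(c_{i,j})_{i,j=0}^{\infty}$ of complex numbers with $c_{i,j}=\overline{c_{j,i}}$ is HPD if $\det\mathbf{M}_n>0$ for all $n\ge 0$, where $\mathbf{M}_n=(c_{i,j})_{i,j=0}^{n}$. $c_{00}$ is the space of complex sequences $v=(v_0,v_1,\dots)$ (row vectors) with only finitely many nonzero entries, and $v^{*}$ is the conjugate transpose of $v$. The matrix $\mathbf{M}$ induces an inner product on the polynomials: for $p(z)=\sum v_kz^{k}$ and $q(z)=\sum w_kz^{k}$, $\langle p,q\rangle=v\mathbf{M}w^{*}$, with norm $\|p\|^2_{P^{2}(\mathbf{M})}=v\mathbf{M}v^{*}$; $P^{2}(\mathbf{M})$ is the completion of the polynomials in this norm. The point $z_0$ is a bounded point evaluation for $P^{2}(\mathbf{M})$ if there is a constant $C>0$ such that $|p(z_0)|\le C\,\|p\|_{P^{2}(\mathbf{M})}$ for every polynomial $p$. Finally (with $0^0=1$), $$\gamma_{z_0}(\mathbf{M})=\inf\Big\{v\mathbf{M}v^{*} : v\in c_{00},\ \sum_{k=0}^{\infty}v_kz_0^{k}=1\Big\}.$$ *)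

(* Defs.v *)
From mathcomp Require Import all_boot all_order all_algebra.
From mathcomp Require Import all_classical all_reals.
From mathcomp Require Import complex.

Set Implicit Arguments.
Unset Strict Implicit.
Unset Printing Implicit Defensive.

Import Order.TTheory GRing.Theory Num.Theory.

Local Open Scope classical_set_scope.
Local Open Scope ring_scope.
Local Open Scope complex_scope.

Definition truncmx (R : realType) (M : nat -> nat -> R[i]) (n : nat) :
  'M[R[i]]_n.+1 := \matrix_(i < n.+1, j < n.+1) M i j.

(* In R[i], [0 < x] means that x is real and positive. *)
Definition HPD (R : realType) (M : nat -> nat -> R[i]) : Prop :=
  (forall i j, M i j = conjc (M j i)) /\ (forall n, 0 < \det (truncmx M n)).

Definition c00 (R : realType) : set (nat -> R[i]) :=
  [set v | finite_set [set k | v k != 0]].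

(* v M w^*; for v and w in c00 both sums have finite support. *)
Definition form (R : realType) (M : nat -> nat -> R[i]) (v w : nat -> R[i]) :
  R[i] :=
  \sum_(i \in [set: nat]) \sum_(j \in [set: nat]) v i * M i j * conjc (w j).

Definition coefs (R : realType) (p : {poly R[i]}) : nat -> R[i] :=
  fun k => p`_k.

Definition inner (R : realType) (M : nat -> nat -> R[i]) (p q : {poly R[i]}) :
  R[i] := form M (coefs p) (coefs q).

(* The inner product of p with itself is real when M is Hermitian, so nothing
   is lost by taking its real part. *)
Definition P2norm (R : realType) (M : nat -> nat -> R[i]) (p : {poly R[i]}) :
  R := Num.sqrt (complex.Re (inner M p p)).

(* The definition constrains polynomials only, so the completion P^2(M) itself
   is not needed. *)
Definition bounded_point_evaluation (R : realType) (M : nat -> nat -> R[i])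
  (z0 : R[i]) : Prop :=
  exists C : R, 0 < C /\
    forall p : {poly R[i]}, `|p.[z0]| <= (C * P2norm M p)%:C.

(* As for P2norm, v M v^* is real when M is Hermitian.  [inf] is the real
   infimum; for M HPD the set is nonempty (it contains the value at
   v = (1, 0, 0, ...)) and bounded below by 0. *)
Definition gamma (R : realType) (M : nat -> nat -> R[i]) (z0 : R[i]) : R :=
  inf [set complex.Re (form M v v) | v in
        [set v | c00 v /\ \sum_(k \in [set: nat]) v k * z0 ^+ k = 1]].

(* Main.v *)
Require Import Defs.
From mathcomp Require Import all_boot all_order all_algebra.
From mathcomp Require Import all_classical all_reals.
From mathcomp Require Import complex.

(** Finitely supported sequences are the coefficient sequences of polynomials,
    so [gamma M z0] is the infimum of [||q||^2] over the polynomials [q] with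
    [q(z0) = 1] ([gammaE]).  The norm is homogeneous ([P2norm_scale]), hence
    the inequality [|p(z0)| <= C ||p||] needs to be known only after
    normalizing [p(z0)] to [1], where it reads [C^-2 <= ||q||^2].  Thus the
    constants [C] of a bounded point evaluation are exactly the positive ones
    for which [C^-2] is a lower bound of the set defining [gamma M z0]; one
    exists if and only if the infimum is positive. *)

Set Implicit Arguments.
Unset Strict Implicit.
Unset Printing Implicit Defensive.

Import Order.TTheory GRing.Theory Num.Theory.

Import Normc.
Local Open Scope classical_set_scope.
Local Open Scope complex_scope.
Local Open Scope ring_scope.

Lemma horner_fsum (F : comNzRingType) (p : {poly F}) (x : F) :
  p.[x] = \sum_(k \in [set: nat]) p`_k * x ^+ k.
Proof.
rewrite horner_coef (fsbig_ord _ _ (fun k => p`_k * x ^+ k)); apply: fsbig_widen => //= k [_ /= /negP].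
by rewrite -leqNgt => pk; rewrite /= nth_default ?mul0r.
Qed.

Lemma c00_coefs (R : realType) (p : {poly R[i]}) : c00 (coefs p).
Proof.
apply: (sub_finite_set _ (finite_II (size p))) => k /=.
by apply: contraR; rewrite -leqNgt => pk; rewrite /coefs nth_default.
Qed.

Lemma c00_poly (R : realType) (v : nat -> R[i]) :
  c00 v -> exists p : {poly R[i]}, coefs p = v.
Proof.
move=> /finite_seqP[s sE]; exists (\poly_(i < (\max_(k <- s) k).+1) v i).
apply/funext => k; rewrite /coefs coef_poly; case: ltnP => // ks.
apply/esym/eqP/negPn/negP => vk; have : [set` s] k by rewrite -sE.
move=> /= ks'; move: ks; rewrite ltnNge => /negP; apply.
exact: (@leq_bigmax_seq _ s xpredT id k).
Qed.

Lemma P2norm_scale (R : realType) (M : nat -> nat -> R[i]) (c : R[i])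
    (p : {poly R[i]}) :
  P2norm M (c *: p) = normc c * P2norm M p.
Proof.
have -> : P2norm M (c *: p) =
    Num.sqrt (complex.Re ((normc c ^+ 2)%:C * inner M p p)).
  congr (Num.sqrt (complex.Re _)).
  have -> : (normc c ^+ 2)%:C = c * conjc c by rewrite -sqr_normc rmorphXn.
  rewrite /inner /form mulr_fsumr; apply: eq_fsbigr => i _.
  rewrite mulr_fsumr; apply: eq_fsbigr => j _.
  rewrite /coefs !coefZ rmorphM /= -!mulrA; congr (_ * _).
  by rewrite [RHS]mulrCA; congr (_ * _); exact: mulrCA.
rewrite /P2norm; case: (inner M p p) => a b /=.
rewrite mul0r subr0 sqrtrM ?sqr_ge0 // sqrtr_sqr ger0_norm //.
by case: c => x y; exact: sqrtr_ge0.
Qed.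

Lemma gammaE (R : realType) (M : nat -> nat -> R[i]) (z0 : R[i]) :
  gamma M z0 = inf [set complex.Re (inner M q q) | q in
                     [set q : {poly R[i]} | q.[z0] = 1]].
Proof.
congr inf; apply/seteqP; split => [_ [v [/c00_poly[q <-] q1] <-]|_ [q q1 <-]].
  by exists q => //=; rewrite horner_fsum.
by exists (coefs q) => //; split; [exact: c00_coefs | rewrite -horner_fsum].
Qed.

(** A real set with no lower bound has infimum [0] by convention, so a positive
    [gamma M z0] is a genuine lower bound. *)
Lemma gamma_le (R : realType) (M : nat -> nat -> R[i]) (z0 : R[i])
    (q : {poly R[i]}) :
  0 < gamma M z0 -> q.[z0] = 1 -> gamma M z0 <= complex.Re (inner M q q).
Proof.
rewrite gammaE; set E := [set _ | _ in _] => E0 q1.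
have [[_ Elb]|/inf_out E_out] := pselect (has_inf E).
  by apply: ge_inf => //; exists q.
by move: E0; rewrite E_out ltxx.
Qed.

Theorem lemma5 (R : realType) (M : nat -> nat -> R[i]) (z0 : R[i])
  (hM : HPD M) :
  bounded_point_evaluation M z0 <-> 0 < gamma M z0.
Proof.
split=> [[C [C0 bpe]]|gamma0].
  apply: (@lt_le_trans _ _ (C^-1 ^+ 2)); first by rewrite exprn_gt0 // invr_gt0.
  rewrite gammaE; apply: lb_le_inf.
    by exists (complex.Re (inner M 1 1)), 1 => //=; rewrite hornerC.
  move=> _ [q /= q1 <-].
  have Cq : C^-1 <= P2norm M q.
    rewrite -[C^-1]mulr1 ler_pdivrMl // -lecR.
    by have := bpe q; rewrite q1 normr1.
  (* [P2norm] is a square root, [0] on negative reals: being positive, it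
     squares back to the inner product. *)
  have q0 : 0 < complex.Re (inner M q q).
    by rewrite -sqrtr_gt0; apply: lt_le_trans Cq; rewrite invr_gt0.
  by rewrite -(sqr_sqrtr (ltW q0)) ler_sqr // nnegrE ?sqrtr_ge0 // invr_ge0 ltW.
exists (Num.sqrt (gamma M z0))^-1; split; first by rewrite invr_gt0 sqrtr_gt0.
move=> p; have [->|pz0] := eqVneq p.[z0] 0.
  by rewrite normr0 ler0c mulr_ge0 ?invr_ge0 ?sqrtr_ge0.
rewrite -[`|_|]/((normc p.[z0])%:C) lecR ler_pdivlMl ?sqrtr_gt0 //.
have normp0 : 0 < normc p.[z0].
  by rewrite -ltcR -[(normc _)%:C]/`|p.[z0]| normr_gt0.
have q1 : (p.[z0]^-1 *: p).[z0] = 1 by rewrite hornerZ mulVf.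
have := gamma_le gamma0 q1 => /ler_wsqrtr.
by rewrite -/(P2norm _ _) P2norm_scale normcV ler_pdivlMl // mulrC.
Qed.
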